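(* Let $G$ be a finite group and let $p<q$ be primes. (1) If $|G/Z(G)|=12$, then $|\operatorname{Cent}(G)|=6$ or $8$. (2) If $|G/Z(G)|=p^2q$ and $|G/Z(G)|\neq 12$, then $|\operatorname{Cent}(G)|=pq+2$ or $q+2$. (3) If $|G/Z(G)|=pq^2$, then $|\operatorname{Cent}(G)|=q^2+2$ or $q^2+q+2$.
   Context: For a group $G$, $Z(G)$ is its center, $C(x)$ is the centralizer of $x$ in $G$, and $\operatorname{Cent}(G)=\{C(x)\mid x\in G\}$ is the set of distinct element centralizers of $G$ (it includes $G=C(1)$ itself). *)

(* Defs.v *)
From HB Require Import structures.
From mathcomp Require Import all_boot all_fingroup all_solvable.

Set Implicit Arguments.
Unset Strict Implicit.
Unset Printing Implicit Defensive.

Local Open Scope group_scope.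

Definition Cent (gT : finGroupType) (G : {group gT}) : {set {set gT}} :=
  [set 'C_G[x] | x in G].

(* Main.v *)
Require Import Defs.
From HB Require Import structures.
From mathcomp Require Import all_boot all_fingroup all_solvable.
From mathcomp Require Import zify ring.

Set Implicit Arguments.
Unset Strict Implicit.
Unset Printing Implicit Defensive.

(* In every case all proper centralizers are abelian, so x |-> C(x) has fibres
   C(x) \ Z(G) on G \ Z(G), and the proper centralizers can be counted by size.
   Sylow's theorem gives a normal subgroup H/Z(G) of G/Z(G) of order r^2 and
   prime index s != r, or M/Z(G) of order q and index p^2.
   - If H is abelian, the proper centralizers are H and subgroups of order s
     modulo Z(G).
   - If H is not abelian, no element outside H commutes with a non-central
     element of H, and all proper centralizers have order r or s modulo Z(G).
   - For M, either C(M) is abelian of index p and the first case applies, or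
     C(M) = M. In the latter case a Sylow p-subgroup S/Z(G) acts faithfully on
     M/Z(G), so S/Z(G) is cyclic and S is abelian: the proper centralizers are
     M and the preimages of the Sylow p-subgroups. This forces p^2 | q - 1, which
     excludes order 12. *)

(** * Counting centralizers by fibres *)

Lemma card_const_fibers (aT rT : finType) (f : aT -> rT) (D : {set aT}) (n : nat) :
  (forall x, x \in D -> #|[set y in D | f y == f x]| = n) ->
  #|D| = #|f @: D| * n.
Proof.
move=> fibD; rewrite -sum1_card (partition_big_imset f) /= -sum_nat_const.
apply: eq_bigr => _ /imsetP[x Dx ->]; rewrite -(fibD x Dx) -sum1_card.
by apply: eq_bigl => y; rewrite inE.
Qed.

Section CentralizerCount.

Local Open Scope group_scope.

Variables (gT : finGroupType) (G : {group gT}).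
Implicit Types (x y : gT) (A D : {set gT}) (H K M : {group gT}).

Lemma abelian_prime_index_center H K :
  H \subset 'Z(K) -> prime #|K : H| -> abelian K.
Proof.
move=> sHZ prKH; apply: (cyclic_factor_abelian sHZ); apply: prime_cyclic.
have sHK: H \subset K := subset_trans sHZ (center_sub K).
by rewrite card_quotient // cents_norm // (subset_trans _ (centS sHZ)) //
  centsC subIset // subxx orbT.
Qed.

(** The fibre over ['C_G[x]] is ['C_G[x] :\: 'Z(G)]: if [y] commutes with [x], abelianness puts
    ['C_G[x]] inside ['C_G[y]], and the common order makes them equal. *)
Lemma card_subcent1_abelian D c :
    D \subset G :\: 'Z(G) ->
    (forall x, x \in D -> abelian 'C_G[x]) ->
    (forall x, x \in D -> #|'C_G[x]| = (c * #|'Z(G)|)%N) ->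
    (forall x, x \in D -> 'C_G[x] :\: 'Z(G) \subset D) ->
  #|D| = (#|[set 'C_G[x] | x in D]| * (c.-1 * #|'Z(G)|))%N.
Proof.
move=> sDG abC oC sCD; apply: card_const_fibers => x Dx.
have /setDP[Gx _] := subsetP sDG x Dx.
have sZC: 'Z(G) \subset 'C_G[x].
  by rewrite subsetI center_sub (subset_trans (subsetIr _ _)) // -cent_set1
    centS // sub1set.
have -> : [set y in D | 'C_G[y] == 'C_G[x]] = 'C_G[x] :\: 'Z(G).
  apply/setP=> y; rewrite inE; apply/andP/idP => [[Dy /eqP <-] | Cy].
    have /setDP[Gy nZy] := subsetP sDG y Dy.
    by rewrite in_setD nZy subcent1_id.
  have Dy := subsetP (sCD x Dx) y Cy; split=> //.
  rewrite eq_sym eqEcard (oC x Dx) (oC y Dy) leqnn andbT subsetI subsetIl /=.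
  have /setDP[Cxy _] := Cy.
  by rewrite sub_cent1 (subsetP (abC x Dx)).
rewrite cardsD (setIidPr sZC) oC //.
by rewrite -subn1 mulnBl mul1n.
Qed.

(** [k1] and [k2] are the numbers of distinct centralizers of elements of [H :\: 'Z(G)] and of
    [G :\: H]; the two order equations determine them by fibre counting. The final 1 counts [G]
    itself. *)
Lemma card_Cent_two_types H c1 c2 k1 k2 :
    'Z(G) \subset H -> H \subset G -> 1 < c1 -> 1 < c2 ->
    (forall x, x \in H :\: 'Z(G) ->
       abelian 'C_G[x] /\ #|'C_G[x]| = (c1 * #|'Z(G)|)%N) ->
    (forall x, x \in G :\: H ->
       [/\ abelian 'C_G[x], #|'C_G[x]| = (c2 * #|'Z(G)|)%N
         & 'C_G[x] :&: H \subset 'Z(G)]) ->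
    #|H| = ((k1 * c1.-1).+1 * #|'Z(G)|)%N ->
    #|G| = (#|H| + k2 * c2.-1 * #|'Z(G)|)%N ->
  #|Cent G| = (k1 + k2 + 1)%N.
Proof.
move=> sZH sHG c1gt1 c2gt1 inH outH oH oG.
have Z0 := cardG_gt0 'Z(G)%G; rewrite /= in Z0.
have sCH x : x \in H :\: 'Z(G) -> 'C_G[x] \subset H.
  case/setDP=> Hx nZx; apply/subsetP=> y /subcent1P[Gy cxy].
  apply: contraR nZx => nHy.
  have Dy: y \in G :\: H by rewrite in_setD nHy.
  have [_ _ /subsetP-> //] := outH y Dy.
  by rewrite inE Hx andbT; apply/subcent1P; split; rewrite ?(subsetP sHG).
have sC1 x : x \in H :\: 'Z(G) -> 'C_G[x] :\: 'Z(G) \subset H :\: 'Z(G).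
  by move=> Hx; rewrite setSD ?sCH.
have sC2 x : x \in G :\: H -> 'C_G[x] :\: 'Z(G) \subset G :\: H.
  move=> Dx; apply/subsetP=> y /setDP[Cy nZy]; rewrite in_setD.
  have [_ _ sCZ] := outH x Dx; rewrite (subsetP (subsetIl G 'C[x])) // andbT.
  by apply: contra nZy => Hy; rewrite (subsetP sCZ) // inE Cy.
have := @card_subcent1_abelian (H :\: 'Z(G)) c1 (setSD _ sHG)
  (fun x Dx => proj1 (inH x Dx)) (fun x Dx => proj2 (inH x Dx)) sC1.
have abC2 x : x \in G :\: H -> abelian 'C_G[x] by case/outH.
have oC2 x : x \in G :\: H -> #|'C_G[x]| = (c2 * #|'Z(G)|)%N by case/outH.
have := @card_subcent1_abelian (G :\: H) c2 (setDS _ sZH) abC2 oC2 sC2.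
rewrite !cardsD (setIidPr sZH) (setIidPr sHG) oG addKn oH mulSn addKn !mulnA.
move/eqP; rewrite eqn_pmul2r // eqn_pmul2r; last by rewrite -ltnS prednK // ltnW.
move/eqP=> Dk2 /eqP.
rewrite eqn_pmul2r // eqn_pmul2r; last by rewrite -ltnS prednK // ltnW.
move/eqP=> Dk1.
have CZ x : x \in 'Z(G) -> 'C_G[x] = G.
  by case/centerP=> Gx cGx; apply/setIidPl; rewrite sub_cent1; apply/centP=> y /cGx.
have nCZ x : x \in G :\: 'Z(G) -> 'C_G[x] != G.
  case/setDP=> Gx; apply: contraNneq => /setIidPl.
  by rewrite sub_cent1 /center inE Gx.
have -> : Cent G = (G : {set gT}) |: ([set 'C_G[x] | x in H :\: 'Z(G)]
                       :|: [set 'C_G[x] | x in G :\: H]).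
  apply/setP=> A; rewrite !inE; apply/idP/idP.
    case/imsetP=> x Gx ->{A}; have [/CZ-> | nZx] := boolP (x \in 'Z(G)).
      by rewrite eqxx.
    have [Hx | nHx] := boolP (x \in H); apply/orP; right; apply/orP.
      by left; apply: imset_f; rewrite in_setD nZx.
    by right; apply: imset_f; rewrite in_setD nHx.
  case/or3P=> [/eqP-> | /imsetP[x /setDP[Hx _] ->] | /imsetP[x /setDP[Gx _] ->]].
  - by apply/imsetP; exists 1; rewrite ?CZ ?group1.
  - by apply: imset_f; apply: (subsetP sHG).
  - exact: imset_f.
rewrite cardsU1 cardsU -Dk1 -Dk2.
(* The two families are disjoint: centralizers of the first kind lie in [H], while one of the second
   kind contains its own [y] outside [H]. *)
set I := _ :&: _; have -> : I = set0.
  apply/eqP; rewrite -subset0; apply/subsetP=> A /setIP[/imsetP[x Dx ->]].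
  case/imsetP=> y Dy eqC; have /setDP[Gy nHy] := Dy.
  have Cy : y \in 'C_G[x] by rewrite eqC subcent1_id.
  by rewrite (subsetP (sCH x Dx) y Cy) in nHy.
rewrite cards0 subn0 addnC; congr (_ + _)%N.
case: (boolP (_ \in _)) => //; rewrite inE => /orP[] /imsetP[x Dx eqG].
  by have := nCZ x (subsetP (setSD _ sHG) x Dx); rewrite -eqG eqxx.
by have := nCZ x (subsetP (setDS _ sZH) x Dx); rewrite -eqG eqxx.
Qed.

(** * Normal subgroups of prime index *)

Lemma sub_center_subcent1 x : x \in G -> 'Z(G) \subset 'Z('C_G[x]).
Proof.
move=> Gx; rewrite subsetI; apply/andP; split; last first.
  exact: subset_trans (subsetIr _ _) (centS (subsetIl _ _)).
by rewrite subsetI center_sub (subset_trans (subsetIr _ _)) // -cent_set1 centS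
  // sub1set.
Qed.

(** Maximality of [H] gives [H * 'C_G[x] = G], and the two factors meet in ['Z(G)]; this yields the
    order. So ['Z(G)] is central of prime index in ['C_G[x]]. *)
Lemma abelian_subcent1_outer H x :
    H <| G -> 'Z(G) \subset H -> prime #|G : H| -> x \in G :\: H ->
    'C_G[x] :&: H \subset 'Z(G) ->
  abelian 'C_G[x] /\ #|'C_G[x]| = (#|G : H| * #|'Z(G)|)%N.
Proof.
move=> nsHG sZH prGH /setDP[Gx nHx] sCHZ; have sHG := normal_sub nsHG.
have sZC := subset_trans (sub_center_subcent1 Gx) (center_sub _).
have eqI : H :&: 'C_G[x] = 'Z(G).
  by apply/eqP; rewrite eqEsubset {1}setIC sCHZ subsetI sZH.
have eqG : H * 'C_G[x] = G.
  apply: mulg_normal_maximal; rewrite ?subsetIl ?p_index_maximal //.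
  by apply/subsetPn; exists x; rewrite ?subcent1_id.
have oC : #|'C_G[x]| = (#|G : H| * #|'Z(G)|)%N.
  apply/eqP; rewrite -(eqn_pmul2l (cardG_gt0 H)) mul_cardG eqG eqI.
  by rewrite -(Lagrange sHG) mulnA.
split=> //; apply: abelian_prime_index_center (sub_center_subcent1 Gx) _.
suff -> : #|'C_G[x] : 'Z(G)| = #|G : H| by [].
by apply/eqP; rewrite -(@eqn_pmul2l #|'Z(G)|) ?cardG_gt0 // Lagrange // oC mulnC.
Qed.

Lemma center_index_not_prime : ~~ prime #|G : 'Z(G)|.
Proof.
apply/negP=> prGZ; have abG := abelian_prime_index_center (subxx _) prGZ.
by move: prGZ; rewrite (center_idP abG) indexgg.
Qed.

(** By maximality of [H], its non-central elements all have centralizer [H], and an outer [x]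
    generates [G] together with [H], so it commutes only with the central elements of [H]. Hence the
    two-type count with [k1 = 1] and [k2 = n]. *)
Lemma card_Cent_abelian_prime_index H n :
    H <| G -> abelian H -> 'Z(G) \subset H -> prime #|G : H| ->
    #|H| = (n * #|'Z(G)|)%N ->
  #|Cent G| = (n + 2)%N.
Proof.
move=> nsHG abH sZH prGH oH; have sHG := normal_sub nsHG.
have n_gt1 : 1 < n.
  case: n oH => [|[|n]] // oH; first by have := cardG_gt0 H; rewrite oH.
  have eqHZ : 'Z(G) = H by apply/eqP; rewrite eqEcard sZH oH mul1n /=.
  by have := center_index_not_prime; rewrite eqHZ prGH.
have inH x : x \in H :\: 'Z(G) -> 'C_G[x] = H.
  case/setDP=> Hx nZx; have Gx := subsetP sHG x Hx.
  have /maxgroupP[_ maxH] : maximal H G by apply: p_index_maximal.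
  apply: (maxH ('C_G[x])%G) => /=; last first.
    by rewrite subsetI sHG sub_cent1 /= (subsetP abH).
  rewrite properE subsetIl subsetI subxx sub_cent1 /=.
  by apply: contra nZx => cGx; rewrite inE Gx.
rewrite (@card_Cent_two_types H n #|G : H| 1 n) //; first by rewrite addnAC addnC.
- exact: prime_gt1.
- by move=> x Hx; rewrite inH.
- move=> x Dx; have /setDP[Gx nHx] := Dx.
  have sCHZ : 'C_G[x] :&: H \subset 'Z(G).
    apply/subsetP=> y /setIP[/setIP[Gy cxy] Hy]; rewrite inE Gy /= -sub_cent1.
    rewrite -(@mulg_normal_maximal _ G H (<[x]>)%G) ?cycle_subG ?p_index_maximal //.
    by rewrite mul_subG ?cycle_subG ?sub_cent1 ?(subsetP abH) // cent1C.
  by have [] := abelian_subcent1_outer nsHG sZH prGH Dx sCHZ.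
- by rewrite mul1n prednK // ltnW.
rewrite -(Lagrange sHG) oH mulnAC -mulnDl -mulnS prednK //; exact: prime_gt0.
Qed.

(** * Powers and coprimality modulo the center *)

Lemma expg_index_normal H K x : K <| H -> x \in H -> x ^+ #|H : K| \in K.
Proof.
move=> /andP[_ nKH] Hx; have nKx := subsetP nKH x Hx.
rewrite coset_idr ?groupX // morphX // -card_quotient // expg_cardG //.
exact: mem_quotient.
Qed.

Lemma coprime_expg_mem K x m n :
  coprime m n -> x ^+ m \in K -> x ^+ n \in K -> x \in K.
Proof.
(* Bezout coefficients from [egcdnP] require [m] positive; for [m = 0], coprimality forces
   [n = 1]. *)
case: (posnP m) => [-> | m_gt0].
  by rewrite /coprime gcd0n => /eqP->.
move/eqP=> co_mn Kxm Kxn.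
have [km kn Dm _] := egcdnP n m_gt0.
rewrite co_mn in Dm; rewrite -(groupMl _ (groupX kn Kxn)) -expgM -expgSr mulnC.
by rewrite -addn1 -Dm mulnC expgM groupX.
Qed.

(** A central commutator satisfies [[~ x, y] ^+ m = [~ x ^+ m, y] = 1], and likewise for [n], so it
    is trivial. *)
Lemma coprime_central_commg x y m n :
    x \in G -> y \in G -> [~ x, y] \in 'Z(G) -> coprime m n ->
    x ^+ m \in 'Z(G) -> y ^+ n \in 'Z(G) ->
  commute x y.
Proof.
move=> Gx Gy Zxy co_mn Zxm Zyn; have cZ z t : z \in 'Z(G) -> t \in G -> commute z t.
  by case/centerP=> _ cz Gt; apply: cz.
suffices /set1gP cxy: [~ x, y] \in 1%G by apply/commgP/eqP.
apply: coprime_expg_mem co_mn _ _; apply/set1gP.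
  rewrite -commXg; last by apply/commute_sym/cZ.
  by apply/eqP/commgP/cZ.
rewrite -commgX; last by apply/commute_sym/cZ.
by apply/eqP/commgP/commute_sym/cZ.
Qed.

(** * Normal subgroups of order [r ^ 2] modulo the center *)

Lemma prime_sqr_indexP r (A H K : {group gT}) :
    prime r -> K \subset A -> A \subset H -> #|H : K| = (r ^ 2)%N ->
  [\/ A :=: K, #|A : K| = r /\ #|H : A| = r | A :=: H].
Proof.
move=> pr_r sKA sAH oHK; have r_gt0 := prime_gt0 pr_r.
have oA := Lagrange_index sAH sKA; rewrite oHK in oA.
have /(dvdn_pfactor _ _ pr_r)[e le_e_2 De]: #|A : K| %| r ^ 2.
  by rewrite -oA dvdn_mull.
rewrite De in oA; case: e De oA le_e_2 => [|[|[|//]]] De oA _.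
- by constructor 1; apply/esym/index1g.
- by constructor 2; split=> //; apply/eqP; rewrite -(eqn_pmul2r r_gt0) oA.
constructor 3; apply/index1g => //; apply/eqP.
by rewrite -(@eqn_pmul2r (r ^ 2)) ?expn_gt0 ?r_gt0 // oA mul1n.
Qed.

(** A larger ['Z(H)] would have index [r] or 1 in [H], making [H] abelian. *)
Lemma center_sub_index_prime_sqr r H :
    prime r -> 'Z(G) \subset H -> H \subset G -> ~~ abelian H ->
    #|H : 'Z(G)| = (r ^ 2)%N ->
  'Z(H) = 'Z(G).
Proof.
move=> pr_r sZH sHG nabH oH.
have sZZ: 'Z(G) \subset 'Z(H).
  by rewrite subsetI sZH (subset_trans (subsetIr _ _)) ?centS.
have [-> // | [_ prHZ] | eqZH] :=
  prime_sqr_indexP pr_r sZZ (center_sub H) oH.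
  by case/negP: nabH; apply: (@abelian_prime_index_center 'Z(H)%G); rewrite ?prHZ.
by case/negP: nabH; rewrite /abelian -{1}eqZH subsetIr.
Qed.

(* A non-central element [x] of [H] commuting with some [y] outside [H] would
   force [y], up to replacing it by a power, to centralize [H / 'Z(G)] and then,
   by coprimality, [H] itself. *)
Lemma subcent1_outer_TI r H y :
    H <| G -> 'Z(G) \subset H -> prime r -> #|H : 'Z(G)| = (r ^ 2)%N ->
    prime #|G : H| -> #|G : H| != r -> ~~ abelian H -> y \in G :\: H ->
  'C_G[y] :&: H \subset 'Z(G).
Proof.
move=> nsHG sZH pr_r oH prGH neq_r nabH Dy; have sHG := normal_sub nsHG.
set s := #|G : H| in prGH neq_r.
have co_rs: coprime (r ^ 2) s.
  by rewrite coprimeXl // prime_coprime // dvdn_prime2 // eq_sym.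
have nsZH : 'Z(G) <| H by apply: normalS (center_normal G).
(* The witness is [y ^+ (r ^ 2)]: its [s]-th power is central, and coprimality of [r ^ 2] and [s]
   keeps it outside [H]. *)
have [t [Gt nHt Zts cyt]] : exists t,
  [/\ t \in G, t \notin H, t ^+ s \in 'Z(G) & 'C[y] \subset 'C[t]].
  have /setDP[Gy nHy] := Dy; exists (y ^+ (r ^ 2)); split.
  - exact: groupX.
  - apply: contra nHy => Hyr; apply: coprime_expg_mem co_rs Hyr _.
    exact: expg_index_normal.
  - by rewrite -expgM mulnC expgM -oH expg_index_normal // expg_index_normal.
  by apply/subsetP=> z /cent1P cyz; apply/cent1P/commuteX.
apply/subsetP=> x /setIP[/subcent1P[Gx cyx] Hx].
have ctx: commute t x.
  by apply/cent1P; rewrite cent1C (subsetP cyt) //; apply/cent1P/commute_sym.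
case: (boolP (x \in 'Z(G))) => // nZx; case/negP: (nHt).
have eqZ := center_sub_index_prime_sqr pr_r sZH sHG nabH oH.
have sZA: 'Z(G) \subset 'C_H[x].
  rewrite subsetI sZH.
  apply: subset_trans (sub_center_subcent1 Gx) _.
  exact: subset_trans (center_sub _) (subsetIr _ _).
have prA: prime #|'C_H[x] : 'Z(G)|.
  have [eqA | [-> //] | eqA] := prime_sqr_indexP pr_r sZA (subsetIl H _) oH.
    by case/negP: nZx; rewrite -eqA subcent1_id.
  case/negP: nZx; rewrite -eqZ inE Hx -sub_cent1 -{1}eqA; exact: subsetIr.
(* ['Z(G)] is maximal in ['C_H[x]], and the elements of ['C_H[x]] commuting with [t] include the
   non-central [x]. *)
have sAt: 'C_H[x] \subset 'C[t].
  have sZI: 'Z(G) \subset 'C_H[x] :&: 'C[t].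
    rewrite subsetI sZA -cent_set1 (subset_trans (subsetIr _ _)) // centS //.
    by rewrite sub1set.
  have /maxgroupP[_ maxZ] := p_index_maximal sZA prA.
  apply: contraR nZx => nsAt.
  have <- : 'C_H[x] :&: 'C[t] = 'Z(G).
    by apply: maxZ => //; rewrite properE subsetIl subsetI subxx.
  by rewrite inE subcent1_id //; apply/cent1P/commute_sym.
(* Since [H / 'Z(G)] is abelian, [x] commutes with [[~ t, h]], which thus lies in ['C_H[x]] and
   commutes with [t]. Its powers of exponents [s] and [r ^ 2] are then central, so it is central
   itself. *)
have cHt h : h \in H -> commute h t.
  move=> Hh; have Gh := subsetP sHG h Hh.
  have Zxh : [~ x, h^-1] \in 'Z(G).
    have abHZ: abelian (H / 'Z(G)).
      by rewrite (card_p2group_abelian pr_r) // card_quotient ?normal_norm.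
    by rewrite (subsetP (der1_min (normal_norm nsZH) abHZ)) // mem_commg ?groupV.
  have Hth : [~ t, h] \in H.
    by rewrite commgEr groupM ?memJ_norm ?groupV // (subsetP (normal_norm nsHG)).
  have cxth: commute x [~ t, h].
    rewrite commgEl; apply: commuteM; first exact/commuteV/commute_sym.
    apply/commgP; rewrite -[x](conjgKV h) -conjRg conjg_eq1.
    have -> : x ^ h^-1 = x * [~ x, h^-1] by rewrite commgEl mulKVg.
    apply/commgP/commute_sym/commuteM => //.
    by case/centerP: Zxh => _ /(_ t Gt)/commute_sym.
  have ctth: commute t [~ t, h].
    by apply/commute_sym/cent1P/(subsetP sAt)/subcent1P.
  have Zth: [~ t, h] \in 'Z(G).
    apply: coprime_expg_mem co_rs _ _; first by rewrite -oH expg_index_normal.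
    by rewrite -commXg //; case/centerP: Zts => _ /(_ h Gh)/commgP/eqP->.
  apply/commute_sym/(@coprime_central_commg t h s (r ^ 2)) => //.
    by rewrite coprime_sym.
  by rewrite -oH expg_index_normal.
rewrite (subsetP sZH) // inE Gt -sub_cent1.
rewrite -(@mulg_normal_maximal _ G H (<[t]>)%G) ?cycle_subG ?p_index_maximal //.
rewrite /= mul_subG ?cycle_subG ?cent1id //.
by apply/subsetP=> h /cHt/cent1P.
Qed.

Lemma card_Cent_prime_sqr r H :
    H <| G -> 'Z(G) \subset H -> prime r -> #|H : 'Z(G)| = (r ^ 2)%N ->
    prime #|G : H| -> #|G : H| != r ->
  #|Cent G| = (r ^ 2 + 2)%N \/ #|Cent G| = (r ^ 2 + r + 2)%N.
Proof.
move=> nsHG sZH pr_r oHZ prGH neq_r; have sHG := normal_sub nsHG.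
have oH : #|H| = (r ^ 2 * #|'Z(G)|)%N by rewrite -oHZ mulnC Lagrange.
have [abH | nabH] := boolP (abelian H).
  by left; apply: card_Cent_abelian_prime_index oH.
right; have r_gt1 := prime_gt1 pr_r.
have TIout y := subcent1_outer_TI nsHG sZH pr_r oHZ prGH neq_r nabH (y := y).
(* Inside [H] there are [r.+1] centralizers because [(r + 1) * (r - 1) + 1 = r ^ 2]; outside there
   are [r ^ 2]. *)
rewrite (@card_Cent_two_types H r #|G : H| r.+1 (r ^ 2)) ?prime_gt1 //.
- by lia.
- move=> x /setDP[Hx nZx]; have Gx := subsetP sHG x Hx.
  have sCH : 'C_G[x] \subset H.
    apply/subsetP=> y /subcent1P[Gy cxy]; apply: contraR nZx => nHy.
    rewrite (subsetP (TIout y _)) ?in_setD ?nHy // inE Hx andbT.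
    exact/subcent1P.
  have sZC := subset_trans (sub_center_subcent1 Gx) (center_sub _).
  have [eqC | [oC _] | eqC] := prime_sqr_indexP pr_r sZC sCH oHZ.
  + by case/negP: nZx; rewrite -eqC subcent1_id.
  + split; last by rewrite -oC mulnC Lagrange.
    by apply: abelian_prime_index_center (sub_center_subcent1 Gx) _; rewrite oC.
  case/negP: nZx.
  rewrite -(center_sub_index_prime_sqr pr_r sZH sHG nabH oHZ) inE Hx -sub_cent1.
  by rewrite -{1}eqC subsetIr.
- move=> x Dx; have sCHZ := TIout x Dx.
  by have [] := abelian_subcent1_outer nsHG sZH prGH Dx sCHZ.
- by rewrite oH; congr (_ * _)%N; nia.
rewrite -(Lagrange sHG) oH mulnAC -mulnDl -mulnS prednK //; exact: prime_gt0.
Qed.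

(** * Normal subgroups of prime order modulo the center *)

(** The conjugation action of [S / 'Z(G)] on [M / 'Z(G)] is faithful: by coprimality a [y] in the
    kernel centralizes [M], hence lies in [M], so both [y ^+ q] and [y ^+ (p ^ 2)] are central. The
    automorphism group is cyclic of order [q.-1]. *)
Lemma quotient_cent_prime_cyclic p q M (S : {group gT}) :
    prime p -> prime q -> p != q -> M <| G -> 'Z(G) \subset M ->
    #|M : 'Z(G)| = q -> 'C_G(M) \subset M ->
    S \subset G -> 'Z(G) \subset S -> #|S : 'Z(G)| = (p ^ 2)%N ->
  cyclic (S / 'Z(G)) /\ p ^ 2 %| q.-1.
Proof.
move=> pr_p pr_q neq_pq nsMG sZM oMZ sCM sSG sZS oSZ.
have nsZM : 'Z(G) <| M by apply: normalS (normal_sub nsMG) (center_normal G).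
have nsZS : 'Z(G) <| S by apply: normalS (center_normal G).
have co_qp2 : coprime q (p ^ 2).
  by rewrite coprimeXr // prime_coprime // dvdn_prime2 // eq_sym.
have oMb : #|M / 'Z(G)| = q by rewrite card_quotient ?normal_norm.
have oSb : #|S / 'Z(G)| = (p ^ 2)%N by rewrite card_quotient ?normal_norm.
have prMb: prime #|M / 'Z(G)| by rewrite oMb.
have nMS : S / 'Z(G) \subset 'N(M / 'Z(G)).
  exact: subset_trans (quotientS _ sSG) (normal_norm (quotient_normal _ nsMG)).
have inj : 'injm (restrm nMS (conj_aut (M / 'Z(G)))).
  rewrite ker_restrm ker_conj_aut; apply/subsetP=> _ /setIP[/morphimP[y Ny Sy ->]].
  move=> /centP cMy; have Gy := subsetP sSG y Sy.
  suffices Zy : y \in 'Z(G) by rewrite inE /= coset_id.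
  apply: coprime_expg_mem (co_qp2) _ _; last by rewrite -oSZ expg_index_normal.
  rewrite -oMZ expg_index_normal // (subsetP sCM) // inE Gy; apply/centP=> m Mm.
  have Gm := subsetP (normal_sub nsMG) m Mm.
  have Nm := subsetP (normal_norm nsZM) m Mm.
  apply/commute_sym/(@coprime_central_commg m y q (p ^ 2)) => //.
  - apply: coset_idr; first by rewrite groupR.
    by rewrite morphR //; apply/eqP/commgP/commute_sym/cMy/mem_quotient.
  - by rewrite -oMZ expg_index_normal.
  by rewrite -oSZ expg_index_normal.
have sIm : restrm nMS (conj_aut (M / 'Z(G))) @* (S / 'Z(G)) \subset Aut (M / 'Z(G)).
  by rewrite morphim_restrm Aut_conj_aut.
split.
  by rewrite -(injm_cyclic inj (subxx _)) (cyclicS sIm) // Aut_prime_cyclic.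
have := cardSg sIm; rewrite (card_injm inj) // oSb.
by rewrite card_Aut_cyclic ?prime_cyclic // oMb totient_prime.
Qed.

(** All non-central elements of [M] share the centralizer ['C_G(M)], whose index over [M] is 1, [p]
    or [p ^ 2]; the last would make [M] central. *)
Lemma card_Cent_normal_prime p q M :
    prime p -> prime q -> p != q -> M <| G -> 'Z(G) \subset M ->
    #|M : 'Z(G)| = q -> #|G : M| = (p ^ 2)%N ->
  #|Cent G| = (p * q + 2)%N \/ #|Cent G| = (q + 2)%N /\ p ^ 2 %| q.-1.
Proof.
move=> pr_p pr_q neq_pq nsMG sZM oMZ oGM; have sMG := normal_sub nsMG.
have oM : #|M| = (q * #|'Z(G)|)%N by rewrite -oMZ mulnC Lagrange.
have abM : abelian M.
  apply: (@abelian_prime_index_center 'Z(G)%G); last by rewrite oMZ.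
  by rewrite subsetI sZM (subset_trans (subsetIr _ _)) ?centS.
have CM x : x \in M :\: 'Z(G) -> 'C_G[x] = 'C_G(M).
  case/setDP=> Mx nZx; apply/eqP; rewrite eqEsubset; apply/andP; split; last first.
    by rewrite setIS // -cent_set1 centS // sub1set.
  rewrite subsetI subsetIl /= centsC.
  have prMZ: prime #|M : 'Z(G)| by rewrite oMZ.
  have /maxgroupP[_ maxZ] := p_index_maximal sZM prMZ.
  have sZI : 'Z(G) \subset 'C_M('C_G[x]).
    by rewrite subsetI sZM (subset_trans (subsetIr _ _)) // centS // subsetIl.
  apply: contraR nZx => nsM; rewrite -(maxZ ('C_M('C_G[x]))%G) //=.
    by rewrite inE Mx -sub_cent1 subsetIr.
  by rewrite properE subsetIl subsetI subxx.
have sMC : M \subset 'C_G(M) by rewrite subsetI sMG.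
have nsCG : 'C_G(M) <| G.
  by have := subcent_normal G M; rewrite (setIidPl (normal_norm nsMG)).
have [eqC | [oC1 oC2] | eqC] := prime_sqr_indexP pr_p sMC (subsetIl G _) oGM.
- right; have sCM : 'C_G(M) \subset M by rewrite eqC.
  have cycS (S : {group gT}) := @quotient_cent_prime_cyclic p q M S
    pr_p pr_q neq_pq nsMG sZM oMZ sCM.
  have nZG := normal_norm (center_normal G).
  have oG : #|G| = (p ^ 2 * q * #|'Z(G)|)%N.
    by rewrite -(Lagrange sMG) oM oGM mulnC mulnA.
  have oGb : #|G / 'Z(G)| = (p ^ 2 * q)%N.
    apply/eqP; rewrite card_quotient // -(eqn_pmul2r (cardG_gt0 'Z(G))) -oG mulnC.
    by rewrite Lagrange ?center_sub.
  have SylQ (Pb : {group coset_of 'Z(G)}) :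
      p.-Sylow(G / 'Z(G)) Pb -> exists S : {group gT},
      [/\ Pb :=: S / 'Z(G), 'Z(G) \subset S, S \subset G & #|S : 'Z(G)| = (p ^ 2)%N].
    move=> sylP; have := inv_quotientS (center_normal G) (pHall_sub sylP).
    case=> S defP sZS sSG; exists S; split=> //.
    rewrite -card_quotient ?(subset_trans sSG) // -defP (card_Hall sylP) oGb.
    rewrite p_part lognM ?expn_gt0 ?prime_gt0 // pfactorK //.
    by rewrite (logn_prime p pr_q) (negPf neq_pq).
  split; last first.
    have [Pb /SylQ[S [_ sZS sSG oS]]] := Sylow_exists p (G / 'Z(G)).
    by have [] := cycS S sSG sZS oS.
  have inM x : x \in M :\: 'Z(G) -> 'C_G[x] = M by move/CM->.
  (* One centralizer, [M], comes from inside, and [q] from outside, since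
     [q + q * (p ^ 2 - 1) = p ^ 2 * q]. *)
  rewrite (@card_Cent_two_types M q (p ^ 2) 1 q) //.
  - by lia.
  - exact: prime_gt1.
  - by rewrite -(expn0 p) ltn_exp2l ?prime_gt1.
  - by move=> x Mx; rewrite inM.
  - move=> x /setDP[Gx nMx].
    have sCZ : 'C_G[x] :&: M \subset 'Z(G).
      apply/subsetP=> y /setIP[/subcent1P[Gy cxy] My]; apply: contraR nMx => nZy.
      by rewrite -(inM y) ?in_setD ?nZy //; apply/subcent1P.
    (* This power lies in [M] and commutes with [x], hence is central; so [x] is a [p]-element
       modulo ['Z(G)] and lies in the preimage [S] of a Sylow subgroup. *)
    have Zxp : x ^+ (p ^ 2) \in 'Z(G).
      rewrite (subsetP sCZ) // inE groupX ?subcent1_id //.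
      by rewrite -oGM expg_index_normal.
    have Nx := subsetP nZG x Gx.
    have px : p.-group <[coset 'Z(G) x]>.
      have : p.-nat (p ^ 2)%N by rewrite pnatX pnat_id.
      apply: pnat_dvd.
      by rewrite -[#|_|]/#[_] order_dvdn -morphX //= coset_id.
    have sxG : <[coset 'Z(G) x]> \subset G / 'Z(G) by rewrite cycle_subG mem_quotient.
    have [Pb sylP sxP] := Sylow_superset sxG px.
    have [S [defP sZS sSG oS]] := SylQ Pb sylP.
    have Sx : x \in S.
      rewrite -cycle_subG -(quotientSGK _ sZS) ?cycle_subG //.
      by rewrite quotient_cycle // -defP.
    have [cS _] := cycS S sSG sZS oS.
    have abS : abelian S.
      apply: cyclic_factor_abelian cS.
      by rewrite subsetI sZS (subset_trans (subsetIr _ _)) ?centS.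
    have cardS : #|S| = (p ^ 2 * #|'Z(G)|)%N by rewrite -oS mulnC Lagrange.
    suffices eqCS : 'C_G[x] = S by rewrite eqCS in sCZ *; split.
    apply/esym/eqP; rewrite eqEcard subsetI sSG sub_cent1 (subsetP abS) //=.
    (* The product formula bounds [#|'C_G[x]| * #|M|] by [#|G| * #|'Z(G)|], which equals
       [#|S| * #|M|]. *)
    rewrite -(leq_pmul2r (cardG_gt0 M)) mul_cardG cardS oM.
    have le_CM : #|'C_G[x] * M| <= #|G| by rewrite subset_leq_card ?mul_subG ?subsetIl.
    rewrite (leq_trans (leq_mul le_CM (subset_leq_card sCZ))) // oG.
    by apply/eq_leq; ring.
  - by rewrite oM mul1n prednK ?prime_gt0.
  rewrite oG oM -mulnDl; congr (_ * _)%N.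
  by have := prime_gt0 pr_p; nia.
- left; have abC : abelian 'C_G(M).
    apply: (@abelian_prime_index_center M); last by rewrite oC1.
    by rewrite subsetI sMC centsC subsetIr.
  apply: card_Cent_abelian_prime_index nsCG abC _ _ _; rewrite ?oC2 //.
    exact: subset_trans sMC.
  by rewrite -(Lagrange sMC) oC1 oM mulnC mulnA.
have sMZ: M \subset 'Z(G) by rewrite subsetI sMG centsC -{1}eqC subsetIr.
have eqMZ : M :=: 'Z(G) by apply/eqP; rewrite eqEsubset sMZ.
by case/negP: (prime_gt1 pr_q); rewrite -oMZ eqMZ indexgg.
Qed.

End CentralizerCount.

(** * Normal Sylow subgroups *)

Section NormalSylow.

Local Open Scope group_scope.

(** The number of Sylow subgroups, [#|G : 'N_G(P)|], divides [#|G : P|] and is 1 modulo [q]. *)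
Lemma normal_Sylow_of_index (gT : finGroupType) (G P : {group gT}) (q : nat) :
    prime q -> q.-Sylow(G) P ->
    (forall d, d %| #|G : P| -> d %% q = 1%N -> d = 1%N) ->
  P <| G.
Proof.
move=> pr_q sylP oneP; have sPG := pHall_sub sylP.
suffices eqN : 'N_G(P) = G by rewrite /normal sPG -{1}eqN subsetIr.
apply: index1g (subsetIl _ _) _; apply: oneP; last first.
  by rewrite -(card_Syl sylP) card_Syl_mod.
by rewrite indexgS // subsetI sPG normG.
Qed.

(* If a Sylow 3-subgroup is not normal then it is self-normalizing, so its
   conjugates contain 8 elements of order 3, leaving room for a single Sylow
   2-subgroup. *)
Lemma group12_normal_subgroup (gT : finGroupType) (G : {group gT}) :
  #|G| = 12 -> exists2 N : {group gT}, N <| G & #|N| = 3 \/ #|N| = 4.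
Proof.
move=> oG.
have [P sylP] := Sylow_exists 3 G; have [T sylT] := Sylow_exists 2 G.
have oP : #|P| = 3 by rewrite (card_Hall sylP) oG p_part.
have oT (S : {group gT}) : 2.-Sylow(G) S -> #|S| = 4.
  by move=> sylS; rewrite (card_Hall sylS) oG p_part.
have [nPG | not_nPG] := boolP (P <| G); first by exists P => //; left.
exists T; last by right; apply: oT.
have sPG := pHall_sub sylP; have pr_P : prime #|P| by rewrite oP.
have iGP : #|G : P| = 4 by rewrite -divgS // oG oP.
have NP : 'N_G(P) = P.
  have sPN : P \subset 'N_G(P) by rewrite subsetI sPG normG.
  have := Lagrange_index (subsetIl G 'N(P)) sPN.
  have := card_Syl_mod G (isT : prime 3); rewrite (card_Syl sylP) iGP.
  have [eqG | neqG] := eqVneq #|G : 'N_G(P)| 1%N.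
    case/negP: not_nPG; rewrite /normal sPG.
    by rewrite -{1}(index1g (subsetIl _ _) eqG) subsetIr.
  move: neqG; set n := #|G : _|; set a := #|_ : P| => n_neq1 n_mod3 n_a.
  apply/esym/index1g => //; rewrite -/a.
  have n_dvd4 : n %| 4 by rewrite -n_a dvdn_mulr.
  have le_n4 : n <= 4 by rewrite dvdn_leq.
  by move: n_a; case: (n) n_neq1 n_mod3 le_n4 => [|[|[|[|[|]]]]] //= *; lia.
(* Each non-trivial element generates [P], so a [g] conjugating one of them into [P] normalizes
   [P]. *)
have tiP : normedTI P^# G P.
  apply/normedTI_memJ_P; split=> //.
    by rewrite setD_eq0 subG1 trivg_card1 oP.
  move=> x g /setD1P[ntx Px] Gg; apply/idP/idP=> [/setD1P[_ Pxg] | Pg]; last first.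
    by rewrite !inE conjg_eq1 ntx groupJ.
  have genP y : y \in P -> y != 1 -> <[y]> = P.
    move=> Py nty; have oy : #[y] = 3.
      apply: (prime_nt_dvdP (isT : prime 3)); first by rewrite order_eq1.
      by rewrite -oP order_dvdG.
    by apply/eqP; rewrite eqEcard cycle_subG Py oP -oy leqnn.
  rewrite -NP inE Gg; apply/normP.
  by rewrite -{1}(genP x) // -cycleJ (genP (x ^ g)) ?conjg_eq1.
have oC : #|class_support P^# G| = 8.
  by rewrite (card_support_normedTI tiP) iGP cardsD (setIidPr (sub1G P)) cards1 oP.
have eqS (S : {group gT}) : 2.-Sylow(G) S -> S :=: G :\: class_support P^# G.
  move=> sylS; have sSG := pHall_sub sylS.
  apply/eqP; rewrite eqEcard subsetD sSG cardsD (setIidPr _) ?oG ?oC ?oT //=.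
    rewrite andbT; apply/pred0P=> x /=; apply/negP=> /andP[Sx].
    case/imset2P=> y g /setD1P[nty Py] Gg Dx.
    have : #[x] %| gcdn 3 4.
      by rewrite dvdn_gcd -(oT S sylS) order_dvdG // Dx orderJ -oP order_dvdG.
    by rewrite dvdn1 Dx orderJ order_eq1 (negPf nty).
  by rewrite class_support_subG // (subset_trans (subsetDl _ _)).
apply/normalP; split; first exact: pHall_sub sylT.
by move=> g Gg; rewrite [RHS](eqS _ sylT) -(eqS (T :^ g)%G) // pHallJ.
Qed.

End NormalSylow.

(** * Arithmetic and assembly of the three cases *)

(** As [q] divides [(p - 1) * (p + 1)] and exceeds [p], it equals [p + 1], and parity decides. *)
Lemma sqr_prime_modn_eq1 p q :
  prime p -> prime q -> p < q -> p ^ 2 %% q = 1%N -> p = 2 /\ q = 3.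
Proof.
move=> pr_p pr_q lt_pq p2q; have p_gt1 := prime_gt1 pr_p.
have : q %| (p - 1) * (p + 1).
  by rewrite -subn_sqr -eqn_mod_dvd ?expn_gt0 ?prime_gt0 //= p2q modn_small ?prime_gt1.
rewrite Euclid_dvdM // => /orP[/dvdn_leq | /dvdn_leq]; first lia.
move=> le_qp; have Dq : q = p.+1 by lia.
case: (even_prime pr_p) => [Dp | odd_p]; first by lia.
by case: (even_prime pr_q) => [|odd_q]; lia.
Qed.

Theorem proposition2p12 (gT : finGroupType) (G : {group gT}) (p q : nat)
    (hp : prime p) (hq : prime q) (hpq : p < q) :
  [/\ #|(G / 'Z(G))%g| = 12 -> #|Cent G| = 6 \/ #|Cent G| = 8,
      #|(G / 'Z(G))%g| = p ^ 2 * q -> #|(G / 'Z(G))%g| <> 12 ->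
        #|Cent G| = p * q + 2 \/ #|Cent G| = q + 2
    & #|(G / 'Z(G))%g| = p * q ^ 2 ->
        #|Cent G| = q ^ 2 + 2 \/ #|Cent G| = q ^ 2 + q + 2].
Proof.
have lift (N : {group coset_of 'Z(G)}) : (N <| G / 'Z(G))%g ->
    exists2 H : {group gT},
        [/\ (H <| G)%g, 'Z(G)%g \subset H & #|H : 'Z(G)|%g = #|N|]
      & #|G : H|%g * #|N| = #|G / 'Z(G)|%g.
  move=> nsN; have [H defN sZH nsHG] := inv_quotientN (center_normal G) nsN.
  have oN : #|N| = #|H : 'Z(G)|%g.
    rewrite defN card_quotient // (subset_trans (normal_sub nsHG)) //.
    exact: normal_norm (center_normal G).
  exists H; rewrite oN // Lagrange_index ?(normal_sub nsHG) //.
  by rewrite card_quotient // normal_norm ?center_normal.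
have p_gt1 := prime_gt1 hp; have q_gt0 := prime_gt0 hq.
have neq_pq : p != q by rewrite ltn_eqF.
split=> [oQ | oQ neq12 | oQ].
- have [N nsN oN] := group12_normal_subgroup oQ.
  have [H [nsHG sZH oH] oGH] := lift N nsN; rewrite oQ in oGH.
  (* For order 3, [2 ^ 2] does not divide 2, so only [2 * 3 + 2 = 8] survives; for order 4, [r = 2]
     gives 6 or 8. *)
  case: oN => oN; rewrite oN in oH oGH.
    have iGH : #|G : H|%g = 2 ^ 2 by lia.
    have := card_Cent_normal_prime (isT : prime 2) (isT : prime 3) isT nsHG sZH.
    by case/(_ oH iGH) => [-> | [_]]; [right |].
  have iGH : #|G : H|%g = 3 by lia.
  have := @card_Cent_prime_sqr _ G 2 H nsHG sZH isT oH.
  by rewrite iGH => /(_ isT isT).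
- have [P sylP] := Sylow_exists q (G / 'Z(G))%G.
  have oP : #|P| = q.
    rewrite (card_Hall sylP) oQ p_part lognM ?expn_gt0 ?prime_gt0 //.
    by rewrite lognX (logn_prime q hp) eq_sym (negPf neq_pq) muln0 logn_prime // eqxx.
  have iP : #|G / 'Z(G) : P|%g = p ^ 2.
    by rewrite -divgS ?(pHall_sub sylP) // oQ oP mulnK.
  have nsP : (P <| G / 'Z(G))%g.
    apply: (normal_Sylow_of_index hq sylP) => d; rewrite iP.
    case/(dvdn_pfactor _ _ hp) => e le_e2 -> {d}.
    (* A Sylow count of [p] is excluded by [p < q]; a count of [p ^ 2] forces order 12. *)
    case: e le_e2 => [|[|[|//]]] _ //; first by rewrite modn_small // => ->.
    move=> /(sqr_prime_modn_eq1 hp hq hpq)[Dp Dq].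
    by case: neq12; rewrite oQ Dp Dq.
  have [H [nsHG sZH oH] oGH] := lift P nsP; rewrite oP in oH oGH.
  have iGH : #|G : H|%g = p ^ 2.
    by apply/eqP; rewrite -(eqn_pmul2r q_gt0) oGH oQ.
  have [-> | [-> _]] := card_Cent_normal_prime hp hq neq_pq nsHG sZH oH iGH.
    by left.
  by right.
have [P sylP] := Sylow_exists q (G / 'Z(G))%G.
have oP : #|P| = q ^ 2.
  rewrite (card_Hall sylP) oQ p_part lognM ?expn_gt0 ?prime_gt0 //.
  by rewrite (logn_prime q hp) eq_sym (negPf neq_pq) pfactorK.
have iP : #|G / 'Z(G) : P|%g = p.
  by rewrite -divgS ?(pHall_sub sylP) // oQ oP mulnK // expn_gt0 q_gt0.
have nsP : (P <| G / 'Z(G))%g.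
  apply: (normal_Sylow_of_index hq sylP) => d; rewrite iP.
  case/primeP: (hp) => _ dvp /dvp/orP[]/eqP-> //.
  by rewrite modn_small.
have [H [nsHG sZH oH] oGH] := lift P nsP; rewrite oP in oH oGH.
have iGH : #|G : H|%g = p.
  by apply/eqP; rewrite -(@eqn_pmul2r (q ^ 2)) ?expn_gt0 ?q_gt0 // oGH oQ.
by apply: card_Cent_prime_sqr nsHG sZH hq oH _ _; rewrite iGH.
Qed.
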